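(* Let $G$ be an oriented hypergraph, with $2$-section $[G]_2$ and strict $2$-section $\llbracket G\rrbracket_2$. Then their adjacency matrices coincide: $A(G)=A(\llbracket G\rrbracket_2)=A([G]_2)$.
   Context: A hypergraph $H=(V,E,\mathcal I)$ consists of a finite set $V=\{v_1,\dots,v_n\}$ of vertices, a finite family $E=(e_\iota)_{\iota\in\Omega}$ of subsets of $V$ (the edges; an edge may be empty, and edges with different indices are regarded as different even if they coincide as sets) and its incidences $\mathcal I$. All hypergraphs are simple: each vertex $v\in e$ is incident with $e$ exactly once, so $\mathcal I=\{(v,e): v\in e\}$. An oriented hypergraph is a pair $G=(H,\sigma)$ with $\sigma:\mathcal I\to\{+1,-1\}$. For an edge $e$ and distinct vertices $v_i,v_j\in e$, put $\mathrm{sgn}_e(v_i,v_j)=-\sigma(v_i,e)\sigma(v_j,e)$. The adjacency matrix $A(G)\in\mathbb R^{n\times n}$ has entries $a_{ij}=\sum_{e}\mathrm{sgn}_e(v_i,v_j)$ for $i\neq j$, the sum being over all edges $e$ containing both $v_i$ and $v_j$ (so $a_{ij}=0$ if there are none), and $a_{ii}=0$. The $2$-section $[G]_2$ is the oriented hypergraph with the same (identically ordered) vertex set as $G$ whose edges are: (1) sets $f\subseteq V$ with $|f|=2$ and $f\subseteq e$ for some $e\in E$, and (2) sets $f$ with $|f|<2$ and $f=e$ for some $e\in E$. The incidence signs of $f$ are carried over from $e$: $\sigma_{[G]_2}(v,f)=\sigma_G(v,e)$ for $v\in f$. The edges are taken with multiplicity: there is one edge $f$ for each pair $(e,f)$ with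 $e\in E$ and $f$ as in (1) or (2). The strict $2$-section $\llbracket G\rrbracket_2$ is defined in the same way but using only the edges of type (1). *)

(* Defs.v *)
From mathcomp Require Import all_boot all_order all_algebra.
From mathcomp Require Import reals.

Set Implicit Arguments.
Unset Strict Implicit.
Unset Printing Implicit Defensive.

Import GRing.Theory.
Local Open Scope ring_scope.

(* The ordered vertex set {v_1, ..., v_n} is 'I_n.  Edges are a family indexed
   by a finite type, so that parallel edges (and empty edges) are allowed.     *)
Record hypergraph (n : nat) := Hypergraph {
  edge_index : finType;
  edge : edge_index -> {set 'I_n}
}.

Definition is_incidence (n : nat) (H : hypergraph n) :
    pred ('I_n * edge_index H) :=
  [pred p | p.1 \in edge p.2].

Definition incidence (n : nat) (H : hypergraph n) : Type :=
  {p : 'I_n * edge_index H | is_incidence p}.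

(* The sign of an incidence is encoded by a boolean b standing for (-1) ^+ b,
   i.e. false is +1 and true is -1.                                            *)
Record ohypergraph (n : nat) := OHypergraph {
  hgraph :> hypergraph n;
  orientation : incidence hgraph -> bool
}.

(* The default value 0, taken when v is not a vertex of e, is never used in
   the adjacency matrix below.                                                 *)
Definition sigma (R : realType) (n : nat) (G : ohypergraph n)
    (v : 'I_n) (e : edge_index G) : R :=
  if insub (v, e) is Some x then (-1) ^+ orientation (x : incidence G) else 0.

Definition edge_sgn (R : realType) (n : nat) (G : ohypergraph n)
    (e : edge_index G) (i j : 'I_n) : R :=
  - (sigma R i e * sigma R j e).

Definition adjacency (R : realType) (n : nat) (G : ohypergraph n) : 'M[R]_n :=
  \matrix_(i < n, j < n)
    if i == j then 0
    else \sum_(e : edge_index G | (i \in edge e) && (j \in edge e))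
           edge_sgn R e i j.

(* For a relation P e f implying f \subset e, the oriented hypergraph having
   one edge f for each pair (e, f) with P e f, signed as e is.                 *)
Definition derived_hypergraph (n : nat) (G : ohypergraph n)
    (P : edge_index G -> pred {set 'I_n}) : hypergraph n :=
  @Hypergraph n {ef : edge_index G * {set 'I_n} | P ef.1 ef.2}
    (fun ef => (val ef).2).

Lemma derived_incidence (n : nat) (G : ohypergraph n)
    (P : edge_index G -> pred {set 'I_n})
    (subP : forall e f, P e f -> f \subset edge e)
    (x : incidence (derived_hypergraph P)) :
  is_incidence ((val x).1, (val (val x).2).1).
Proof. exact: (subsetP (subP _ _ (valP (val x).2)) _ (valP x)). Qed.

Definition derived_ohypergraph (n : nat) (G : ohypergraph n)
    (P : edge_index G -> pred {set 'I_n})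
    (subP : forall e f, P e f -> f \subset edge e) : ohypergraph n :=
  @OHypergraph n (derived_hypergraph P)
    (fun x => @orientation n G
      (exist (fun p => is_incidence p) _ (derived_incidence subP x))).

Definition pair_of_edge (n : nat) (G : ohypergraph n) (e : edge_index G) :
    pred {set 'I_n} :=
  [pred f : {set 'I_n} | (#|f| == 2) && (f \subset edge e)].

Definition small_edge (n : nat) (G : ohypergraph n) (e : edge_index G) :
    pred {set 'I_n} :=
  [pred f : {set 'I_n} | (#|f| < 2)%N && (f == edge e)].

Definition two_section_edge (n : nat) (G : ohypergraph n) (e : edge_index G) :
    pred {set 'I_n} :=
  [pred f | pair_of_edge e f || small_edge e f].

Lemma pair_of_edge_sub (n : nat) (G : ohypergraph n) (e : edge_index G)
    (f : {set 'I_n}) :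
  pair_of_edge e f -> f \subset edge e.
Proof. by case/andP. Qed.

Lemma two_section_edge_sub (n : nat) (G : ohypergraph n) (e : edge_index G)
    (f : {set 'I_n}) :
  two_section_edge e f -> f \subset edge e.
Proof. by case/orP => /andP[_] // /eqP ->. Qed.

Definition two_section (n : nat) (G : ohypergraph n) : ohypergraph n :=
  derived_ohypergraph (@two_section_edge_sub n G).

Definition strict_two_section (n : nat) (G : ohypergraph n) : ohypergraph n :=
  derived_ohypergraph (@pair_of_edge_sub n G).

(* Main.v *)
Require Import Defs.
From mathcomp Require Import all_boot all_order all_algebra.
From mathcomp Require Import reals.

Set Implicit Arguments.
Unset Strict Implicit.
Unset Printing Implicit Defensive.

Import GRing.Theory.
Local Open Scope ring_scope.

(** Passing to a section keeps signs ([sigma_derived]), and for i != j the pairs (e, f) with i, j in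
    f correspond bijectively to the edges e containing i and j, since f must be {i, j}. So the
    entries agree term by term. Edges with fewer than two vertices never count, hence
    [adjacency_derived] treats both sections at once. *)

Lemma sigma_derived (R : realType) (n : nat) (G : ohypergraph n)
    (P : edge_index G -> pred {set 'I_n})
    (subP : forall e f, P e f -> f \subset edge e)
    (v : 'I_n) (ef : edge_index (derived_ohypergraph subP)) :
  v \in edge ef -> sigma R v ef = sigma R v (val ef).1.
Proof.
move=> v_f; have v_e := subsetP (subP _ _ (valP ef)) _ v_f.
rewrite /sigma.
rewrite (insubT (@is_incidence n (derived_hypergraph P))
  (v_f : is_incidence (v, ef))) /=.
rewrite (insubT (@is_incidence n G)
  (v_e : is_incidence (v, (val ef).1))) /=.
(* Both incidences of [G] have the same underlying pair; only their membership proofs may differ. *)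
by congr (_ ^+ (orientation _ : bool)); apply: val_inj.
Qed.

(* An off-diagonal entry at (i, j) only sees edges containing both i and j; an
   edge e of G with this property contributes exactly one derived edge to the
   sum, namely {i, j}. *)
Lemma adjacency_derived (R : realType) (n : nat) (G : ohypergraph n)
    (P : edge_index G -> pred {set 'I_n})
    (subP : forall e f, P e f -> f \subset edge e) :
  (forall e (f : {set 'I_n}), (1 < #|f|)%N -> P e f = pair_of_edge e f) ->
  adjacency R (derived_ohypergraph subP) = adjacency R G.
Proof.
move=> P_pair; apply/matrixP => i j; rewrite !mxE.
have [//|neq_ij] := eqVneq i j.
transitivity (\sum_(ef : edge_index (derived_ohypergraph subP)
    | (i \in (val ef).2) && (j \in (val ef).2)) edge_sgn R (val ef).1 i j).
  apply: eq_bigr => ef /andP[i_f j_f].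
  by rewrite /edge_sgn !sigma_derived.
(* The index sets of the two sums match: an f containing i and j has more than one element, so
   [P_pair] forces #|f| = 2 and f = {i, j}. *)
have pairP e f : P e f && ((i \in f) && (j \in f)) =
    ((i \in edge e) && (j \in edge e)) && (f == [set i; j]).
  have [-> | neq_f] := eqVneq f [set i; j].
    by rewrite P_pair /pair_of_edge /= ?cards2 ?neq_ij // subUset !sub1set !inE
      !eqxx orbT !andbT.
  rewrite andbF; apply: contraNF neq_f => /andP[Pf /andP[i_f j_f]].
  have sub_ij : [set i; j] \subset f by rewrite subUset !sub1set i_f.
  have card_ij : #|[set i; j]| = 2%N by rewrite cards2 neq_ij.
  have f_gt1 : (1 < #|f|)%N by rewrite -card_ij subset_leq_card.
  move: Pf; rewrite P_pair // => /andP[/eqP f2 _].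
  by rewrite eq_sym eqEcard sub_ij f2 card_ij.
(* A dummy sum over the single f = {i, j} turns the sum over e into one over pairs (e, f), which is
   then reindexed along [val] with partial inverse [insub]. *)
symmetry; transitivity (\sum_(e : edge_index G
    | (i \in edge e) && (j \in edge e)) \sum_(f | f == [set i; j]) edge_sgn R e i j).
  by apply: eq_bigr => e _; rewrite big_pred1_eq.
rewrite pair_big_dep (reindex_omap
  (val : edge_index (derived_ohypergraph subP) -> _) insub) => [|ef]; last first.
  by rewrite -pairP => /andP[Pef _]; rewrite insubT.
by apply: eq_bigl => ef; rewrite -pairP valK eqxx andbT (valP ef).
Qed.

Theorem theorem4p1 (R : realType) (n : nat) (G : ohypergraph n) :
  adjacency R G = adjacency R (strict_two_section G) /\
  adjacency R (strict_two_section G) = adjacency R (two_section G).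
Proof.
rewrite !adjacency_derived // => e f f_gt1.
(* A set with more than one element cannot be a [small_edge]. *)
by rewrite /two_section_edge /small_edge /= ltnNge f_gt1 orbF.
Qed.
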